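(* Fix $\alpha\in(1,\tfrac32]$ and a constant $c>0$. Let $N\ge1$, $\delta=N^{-\alpha}$, and let $A\subset[1,2]\cap\delta\mathbb{Z}$ with $|A|=N$ such that $A$ is $\sim N^{-1}$-separated, i.e. $|a-a'|\ge cN^{-1}$ for all distinct $a,a'\in A$. Then for every $\epsilon>0$, $$\mathcal{N}(A+A,\delta)\cdot\mathcal{N}(AA,\delta)\gtrsim_{\epsilon}N^{1+\alpha-\epsilon},$$ with implicit constant independent of $N$ and $A$.
   Context: $A+A=\{a+a':a,a'\in A\}$, $AA=\{aa':a,a'\in A\}$, $\delta\mathbb{Z}=\{\delta k:k\in\mathbb{Z}\}$. For $B\subset\mathbb{R}$, $\mathcal{N}(B,\delta)$ denotes the maximal cardinality of a $\delta$-separated subset of $B$. *)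

(* Defs.v *)
From HB Require Import structures.
From mathcomp Require Import all_boot all_order all_algebra finmap.
From mathcomp Require Import all_classical all_reals all_analysis.

Set Implicit Arguments.
Unset Strict Implicit.
Unset Printing Implicit Defensive.

Import Order.TTheory GRing.Theory Num.Theory.

Local Open Scope classical_set_scope.
Local Open Scope ring_scope.

Definition dist_separated (R : realType) (r : R) (B : set R) : Prop :=
  forall x y, B x -> B y -> x <> y -> r <= `|x - y|.

(* A supremum in the extended reals, so that it is total: it is the maximum
   when the cardinalities are bounded (see packing_number_max), in particular
   when B is bounded and 0 < delta, and +oo otherwise. *)
Definition packing_number (R : realType) (B : set R) (delta : R) : \bar R :=
  ereal_sup [set (#|` S|%fset%:R : R)%:E | S in
    [set S : {fset R} | [set` S] `<=` B /\ dist_separated delta [set` S]]].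

Lemma packing_number_max (R : realType) (B : set R) (delta : R) (S : {fset R}) :
    [set` S] `<=` B -> dist_separated delta [set` S] ->
    (forall T : {fset R}, [set` T] `<=` B -> dist_separated delta [set` T] ->
       (#|` T|%fset <= #|` S|%fset)%N) ->
  packing_number B delta = (#|` S|%fset%:R : R)%:E.
Proof.
move=> SB Ssep Smax; apply/eqP; rewrite eq_le; apply/andP; split.
  by apply: ge_ereal_sup => _ [T [TB Tsep] <-]; rewrite lee_fin ler_nat Smax.
by apply: ereal_sup_ubound; exists S.
Qed.

Definition sumset (R : realType) (A B : set R) : set R :=
  [set a + b | a in A & b in B].

Definition productset (R : realType) (A B : set R) : set R :=
  [set a * b | a in A & b in B].

Definition multiples (R : realType) (delta : R) : set R :=
  [set delta * k%:~R | k in [set: int]].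

(* Main.v *)
(** Write a = delta * b with b an integer, so that B = A / delta is a set of N
    integers in [n, 2n], n ~ 1 / delta. For a, b in B consider the thin tube
    { (x, y) : y = a (x - b) + O(1 / delta) }. The N^2 tubes contain together
    N^3 incidences with the points of (B + B) x BB, as a ((b + c) - b) = ac.
    Fatten every tube by the factor W ~ N^(alpha - 1), which is the spacing of B.
    By separation a point lies in O(N) fat tubes. On the other hand the
    differences (W * thin - fat) of two tubes of distinct slopes are exactly
    orthogonal over unbounded x, since W * thin - fat has mean zero; cutting x off
    to a bounded range only leaves the pairs meeting near the two ends of this
    range. Thus W * thin is O(N) up to an error with small L2 norm, and counting
    incidences bounds |B + B| |BB| from below by a constant times N^(1 + alpha). *)
Require Import Defs.
From HB Require Import structures.
From mathcomp Require Import all_boot all_order all_algebra finmap.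
From mathcomp Require Import all_classical all_reals all_analysis.
From mathcomp Require Import zify ring lra.

Set Implicit Arguments.
Unset Strict Implicit.
Unset Printing Implicit Defensive.

Import Order.TTheory GRing.Theory Num.Theory.

Local Open Scope classical_set_scope.
Local Open Scope ring_scope.

(** * The balanced kernel and its discrete primitive *)

Section kernel.
Variable R : realFieldType.

Definition window (l : nat) (v : int) : R := ((0 <= v) && (v < l%:Z))%:R.

(** The thin window scaled by W minus the fat one: its sum is 0. *)
Definition kernel (q W : nat) (v : int) : R :=
  W%:R * window q v - window (q * W) v.

(** primitive m W h v is the sum of kernel (m * h) W (v - j * h) over j > 0. It is
    supported in (0, m * h * W) because the sum of the kernel over every residue
    class modulo h is 0; this is where h is required to divide the width m * h. *)
Definition primitive (m W h : nat) (v : int) : R :=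
  let d := if v is Posz p then (p %/ h)%N else 0%N in
  W%:R * (minn d m)%:R - (minn d (m * W))%:R.

Lemma primitive_telescope m W h v : (0 < h)%N ->
  primitive m W h (v + h%:Z) - primitive m W h v = kernel (m * h) W v.
Proof.
move=> h0; rewrite /primitive /kernel /window.
case: v => [p|p].
  rewrite -PoszD divnDr ?dvdnn// divnn h0 /= !ltz_nat.
  have H (l : nat) : (p < l * h)%N = (p %/ h < l)%N by rewrite ltn_divLR.
  rewrite mulnAC !H addn1.
  set d := (p %/ h)%N.
  have E (l : nat) : (minn d.+1 l)%:R = (minn d l)%:R + (d < l)%N%:R :> R.
    by rewrite -natrD; congr _%:R; lia.
  by rewrite !E; ring.
(* For negative [v] the shifted argument lies below [h], so its quotient is 0 even when it is
   nonnegative. *)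
have -> : (match Negz p + h%:Z with Posz p0 => (p0 %/ h)%N | Negz _ => 0%N end = 0%N).
  case E : (Negz p + h%:Z) => [r|//]; apply: divn_small; move: E; lia.
by rewrite /= !min0n; ring.
Qed.

Lemma primitive_eq0 m W h v : (0 < h)%N ->
  (v <= 0) || ((m * h * W)%:Z <= v) -> primitive m W h v = 0.
Proof.
move=> h0; rewrite /primitive; case: v => [p|p]; last by rewrite !min0n mulr0 subrr.
rewrite lez_nat => /orP[p0|].
  by move: p0; rewrite lez0_nat => /eqP->; rewrite div0n !min0n; ring.
rewrite mulnAC -leq_divRL// => H; case: W H => [|W] H.
  by rewrite muln0 minn0 mul0r subrr.
have H1 : (m <= p %/ h)%N by apply: leq_trans H; rewrite leq_pmulr.
by rewrite (minn_idPr H) (minn_idPr H1) natrM mulrC subrr.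
Qed.

Lemma primitive_bound m W h v : `|primitive m W h v| <= (m * W)%:R.
Proof.
rewrite /primitive; set d := (if v is Posz p then (p %/ h)%N else 0%N).
have [->|W0] := eqVneq W 0%N.
  by rewrite muln0 minn0 mul0r subrr normr0.
rewrite -natrM -natrB; last by nia.
by rewrite normr_nat ler_nat; nia.
Qed.

Lemma kernel_eq0 q W v : (0 < W)%N -> ~~ ((0 <= v) && (v < (q * W)%:Z)) ->
  kernel q W v = 0.
Proof.
move=> W0 H; rewrite /kernel /window (negbTE H).
suff -> : (0 <= v) && (v < q%:Z) = false by rewrite mulr0n mulr0 subrr.
by apply/negbTE; move: H; apply: contra => /andP[-> /= H]; nia.
Qed.

Lemma kernel_bound q W v : (0 < W)%N -> `|kernel q W v| <= W%:R.
Proof.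
move=> W0; rewrite /kernel /window.
have W1 : 1 <= W%:R :> R by rewrite ler1n.
by case: (_ && _); case: (_ && _); rewrite /= ler_norml; apply/andP; split; lra.
Qed.

(** Counted with their weights, the thin and the fat window both have mass [q * W]; the triangle
    inequality adds the two. *)
Lemma sum_kernel_le q W : \sum_(0 <= u < q * W) `|kernel q W u%:Z| <= (2 * (q * W))%:R.
Proof.
apply: (@le_trans _ _ (\sum_(0 <= u < q * W) (W%:R * (u < q)%:R + 1))).
  apply: ler_sum => u _; rewrite /kernel /window !lez_nat !ltz_nat /=.
  have W1 : 0 <= W%:R :> R by rewrite ler0n.
  by case: (_ < q)%N; case: (_ < q * W)%N; rewrite /= ler_norml; apply/andP; split; lra.
rewrite big_split /= sumr_const_nat subn0 -mulr_sumr mul2n -addnn natrD lerD2r.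
rewrite mulnC natrM ler_wpM2l// -natr_sum ler_nat.
have -> : (\sum_(0 <= u < W * q) (u < q))%N = minn (W * q) q.
  elim: (W * q)%N => [|j IHj]; first by rewrite big_geq// min0n.
  by rewrite big_nat_recr//= IHj; lia.
by rewrite geq_minr.
Qed.

End kernel.

(** * Correlations of shifted kernels *)

Section correlation.
Variable R : realFieldType.

Lemma sum_shift (F : int -> R) (w m : nat) (t : int) :
  (forall v, ~~ ((0 <= v) && (v < w%:Z)) -> F v = 0) ->
  0 <= t -> t + w%:Z <= m%:Z ->
  \sum_(0 <= e < m) F (e%:Z - t) = \sum_(0 <= u < w) F u%:Z.
Proof.
move=> F0; case: t => [t|//] _ tm.
have tm' : (t + w <= m)%N by lia.
have Z a b : (forall i, (a <= i < b)%N -> F (i%:Z - t%:Z) = 0) ->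
    \sum_(a <= e < b) F (e%:Z - t%:Z) = 0.
  by move=> H; apply: big1_seq => i; rewrite mem_index_iota => /H.
rewrite (@big_cat_nat _ _ _ t)//=; last by lia.
rewrite Z ?add0r => [|i it]; last by apply: F0; lia.
rewrite (@big_cat_nat _ _ _ (t + w)%N)//=; last by lia.
rewrite addrC Z ?add0r => [|i it]; last by apply: F0; lia.
rewrite -[LHS]/(\sum_((0 + t)%N <= e < (t + w)%N) F (e%:Z - t%:Z)) big_addn addKn.
apply: eq_bigr => i _; by congr F; lia.
Qed.

Definition correlation (q W : nat) (s : int) : R :=
  \sum_(0 <= u < q * W) kernel R q W u%:Z * kernel R q W (u%:Z + s).

(** Only the window placed at [t] has to fit into [[0, m)]: outside its support the product
    vanishes. *)
Lemma sum_kernel2 q W m (t t' : int) : (0 < W)%N -> 0 <= t -> t + (q * W)%:Z <= m%:Z ->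
  \sum_(0 <= e < m) kernel R q W (e%:Z - t) * kernel R q W (e%:Z - t') =
  correlation q W (t - t').
Proof.
move=> W0 t0 tm.
pose F u := kernel R q W u * kernel R q W (u + (t - t')).
transitivity (\sum_(0 <= e < m) F (e%:Z - t)).
  by apply: eq_bigr => e _; congr (_ * kernel _ _ _ _); ring.
by apply: sum_shift => // v H; rewrite /F kernel_eq0// mul0r.
Qed.

(** Serves twice: with [g] the kernel it bounds a single correlation, with [g] the primitive it
    bounds the end terms of a telescoped sum of correlations. *)
Lemma sum_kernel_mul q W (g : int -> R) (M : nat) (s : int) :
  (forall v, `|g v| <= M%:R) ->
  (forall v, (v < 0) || ((q * W)%:Z <= v) -> g v = 0) ->
  `|\sum_(0 <= u < q * W) kernel R q W u%:Z * g (u%:Z + s)|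
    <= (2 * (q * W) * M * (`|s| < (q * W)%:Z)%R)%:R.
Proof.
move=> gM g0; case: ltP => sw.
  apply: le_trans (ler_norm_sum _ _ _) _.
  apply: (@le_trans _ _ (\sum_(0 <= u < q * W) `|kernel R q W u%:Z| * M%:R)).
    by apply: ler_sum => u _; rewrite normrM ler_wpM2l.
  by rewrite -mulr_suml muln1 natrM ler_wpM2r// sum_kernel_le.
rewrite muln0 big1_seq ?normr0// => u; rewrite mem_index_iota => uw.
by rewrite g0 ?mulr0//; lia.
Qed.

Lemma correlation_le q W s : (0 < W)%N ->
  `|correlation q W s| <= (2 * (q * W) * W * (`|s| < (q * W)%:Z)%R)%:R.
Proof.
move=> W0; apply: sum_kernel_mul => v; first exact: kernel_bound.
by move=> H; apply: kernel_eq0 => //; lia.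
Qed.

(** When [x] grows by 1 the shift grows by [h], so summing the second kernel over [x] telescopes to
    its primitive. Only the two ends survive, and each vanishes unless the shift there is below the
    fat width. *)
Lemma sum_correlation_le m W h x1 x2 s : (0 < h)%N -> (x1 <= x2)%N ->
  `|\sum_(x1 <= x < x2) correlation (m * h) W (h%:Z * x%:Z + s)| <=
  (2 * (m * h * W) * (m * W) * ((`|h%:Z * x1%:Z + s| < (m * h * W)%:Z)%R +
     (`|h%:Z * x2%:Z + s| < (m * h * W)%:Z)%R))%:R.
Proof.
move=> h0 x12; rewrite /correlation exchange_big_nat /=.
under eq_bigr => u _ do rewrite -mulr_sumr.
pose p (x : nat) (u : nat) := primitive R m W h (u%:Z + (h%:Z * x%:Z + s)).
have E u : \sum_(x1 <= x < x2) kernel R (m * h) W (u%:Z + (h%:Z * x%:Z + s)) =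
    p x2 u - p x1 u.
  rewrite -(@telescope_sumr _ x1 x2 (fun x => p x u))//; apply: eq_bigr => x _.
  rewrite -primitive_telescope// /p; congr (primitive _ _ _ _ _ - _).
  by rewrite -addn1 PoszD; ring.
under eq_bigr => u _ do rewrite E mulrBr.
rewrite sumrB mulnDr natrD addrC; apply: le_trans (ler_normD _ _) _; rewrite normrN.
by apply: lerD; apply: sum_kernel_mul => v; rewrite ?primitive_bound// => H;
  rewrite primitive_eq0//; lia.
Qed.

End correlation.

(** * Counting separated integers, and the energy of the tubes *)

Lemma size_separated (W k l : nat) (s : seq nat) : (0 < W)%N -> (0 < k)%N -> (0 < l)%N ->
  uniq s ->
  (forall x y, x \in s -> y \in s -> x < y -> W <= k * (y - x))%N ->
  (forall x y, x \in s -> y \in s -> x < y -> y - x < l * W)%N ->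
  (size s <= k * l)%N.
Proof.
move=> W0 k0 l0 us sep diam.
case: (posnP (size s)) => [->//|s0].
have [x0 x0s x0min] : exists2 x0, x0 \in s & forall x, x \in s -> (x0 <= x)%N.
  have ex : exists x, x \in s by exists (nth 0%N s 0); rewrite mem_nth.
  by exists (ex_minn ex); case: ex_minnP.
(* Pigeonhole: separation makes [f] injective on [s], and the diameter bound puts its values in
   [[0, k * l)]. *)
pose f x := ((k * (x - x0)) %/ W)%N.
rewrite -(size_map f) -(size_iota 0 (k * l)); apply: uniq_leq_size.
  rewrite map_inj_in_uniq// => x y xs ys; rewrite /f => fxy.
  wlog xy : x y xs ys fxy / (x <= y)%N.
    by move=> H; case: (leqP x y) => [|/ltnW] xy; [|apply/esym]; apply: H.
  apply/eqP; rewrite eqn_leq xy leqNgt; apply/negP => xlty.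
  have := sep _ _ xs ys xlty.
  have := x0min _ xs => x0x.
  have -> : (y - x = (y - x0) - (x - x0))%N by lia.
  rewrite mulnBr.
  have := divn_eq (k * (x - x0)) W; have := divn_eq (k * (y - x0)) W.
  rewrite -fxy; have := ltn_pmod (k * (x - x0)) W0; have := ltn_pmod (k * (y - x0)) W0.
  lia.
move=> _ /mapP[x xs ->]; rewrite mem_iota add0n /= /f ltn_divLR// -mulnA ltn_pmul2l//.
have := x0min _ xs; rewrite leq_eqVlt => /predU1P[<-|]; first by rewrite subnn muln_gt0 l0.
exact: diam.
Qed.

(** The x-axis has mesh delta / L and the y-axis mesh delta ^ 2 / L, so that tubes
    have the slopes a in B and integer positions. The refinement L is only there to
    make the width q = L * n divisible by all differences of slopes. *)
Section energy.
Variables (R : realFieldType) (B : seq nat) (n W k L : nat).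
Hypotheses (n_gt0 : (0 < n)%N) (W_gt0 : (0 < W)%N) (k_gt0 : (0 < k)%N) (L_gt0 : (0 < L)%N).
Hypothesis L_dvd : forall h, (0 < h <= n)%N -> (h %| L)%N.
Hypothesis B_uniq : uniq B.
Hypothesis B_range : forall b, b \in B -> (n <= b <= 2 * n)%N.
Hypothesis B_separated : forall x y, x \in B -> y \in B -> (x < y -> W <= k * (y - x))%N.

Let q := (L * n)%N.
Let w := (q * W)%N.

Definition position (a b x : nat) : int := a%:Z * (x%:Z - (L * b)%:Z).

Definition tube_sum (x e : nat) : R :=
  \sum_(a <- B) \sum_(b <- B) kernel R q W (e%:Z - position a b x).

(** The sums of two elements of [B] lie in [[2n, 4n]], and a sum [x] owns the [L] columns
    [x * L + i] with [i < L]; hence the [+ 1] in [last]. *)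
Let first := (2 * n * L)%N.
Let last := ((4 * n + 1) * L)%N.
(* All the tubes stay in [0, height) for first <= x < last. *)
Definition height := (2 * n * last + w)%N.

Lemma count_separated l (p : pred nat) : (0 < l)%N ->
  (forall x y, x \in B -> y \in B -> p x -> p y -> x < y -> y - x < l * W)%N ->
  (count p B <= k * l)%N.
Proof.
move=> l0 H; rewrite -size_filter; apply: (@size_separated W) => //.
- exact: filter_uniq.
- by move=> x y; rewrite !mem_filter => /andP[_ xB] /andP[_ yB]; apply: B_separated.
- by move=> x y; rewrite !mem_filter => /andP[px xB] /andP[py yB]; apply: H.
Qed.

(** Raising [b] by 1 lowers the tube by [L * a >= L * n], so the values of [b] whose tubes of slope
    [a] come within [w] of [t] differ by less than [2 * W]. *)
Lemma count_position a x (t : int) : a \in B ->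
  (count (fun b => (`|t - position a b x| < w%:Z)%R) B <= k * 2)%N.
Proof.
move=> aB; apply: count_separated => // b b' bB b'B Hb Hb' bb'.
have := B_range aB => /andP[na _].
rewrite ltnNge; apply/negP => H.
have : (2 * w <= L * a * (b' - b))%N.
  rewrite /w /q; apply: (@leq_trans (L * n * (2 * W))%N); first by lia.
  by apply: leq_mul => //; rewrite leq_mul2l na orbT.
move: Hb Hb'; rewrite /position.
have -> : t - a%:Z * (x%:Z - (L * b')%:Z) = t - a%:Z * (x%:Z - (L * b)%:Z) + (L * a * (b' - b))%:Z.
  by rewrite !PoszM -subzn 1?ltnW//; ring.
lia.
Qed.

Lemma position_range a b x : a \in B -> b \in B -> (first <= x < last)%N ->
  0 <= position a b x /\ position a b x + w%:Z <= height%:Z.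
Proof.
move=> aB bB /andP[x1 x2]; split.
  rewrite /position mulr_ge0//; move: x1; rewrite /first => x1.
  have := B_range bB => /andP[_ b2].
  suff : (L * b <= x)%N by lia.
  by apply: leq_trans x1; rewrite [leqRHS]mulnC leq_mul2l b2 orbT.
rewrite /height -/w PoszD lerD2r /position.
apply: (@le_trans _ _ (a%:Z * x%:Z)); first by rewrite ler_wpM2l//; lia.
rewrite -PoszM lez_nat; apply: leq_mul; last exact: ltnW.
by have /andP[] := B_range aB.
Qed.

Definition inner (a b a' b' : nat) : R :=
  \sum_(first <= x < last) \sum_(0 <= e < height)
    kernel R q W (e%:Z - position a b x) * kernel R q W (e%:Z - position a' b' x).

Lemma innerC a b a' b' : inner a b a' b' = inner a' b' a b.
Proof. by apply: eq_bigr => x _; apply: eq_bigr => e _; rewrite mulrC. Qed.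

Lemma inner_correlation a b a' b' : a \in B -> b \in B ->
  inner a b a' b' =
  \sum_(first <= x < last) correlation R q W (position a b x - position a' b' x).
Proof.
move=> aB bB; rewrite /inner !big_seq; apply: eq_bigr => x.
rewrite mem_index_iota => xr; have [p0 pw] := position_range aB bB xr.
exact: sum_kernel2.
Qed.

(** Parallel tubes keep a constant offset, so nothing cancels along [x] and each correlation is
    bounded on its own. *)
Lemma inner_same_le a b b' : a \in B -> b \in B ->
  `|inner a b a b'| <= \sum_(first <= x < last)
     (2 * w * W * (`|position a b x - position a b' x| < w%:Z)%R)%:R.
Proof.
move=> aB bB; rewrite inner_correlation//; apply: le_trans (ler_norm_sum _ _ _) _.
by apply: ler_sum => x _; apply: correlation_le.
Qed.

Definition gap (a a' : nat) : nat := (a - a') + (a' - a).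

(** With [h] the gap and [q = m * h], the end terms of [sum_correlation_le] have size
    [2 * w * (m * W) = 2 * w ^ 2 / h]. *)
Lemma inner_distinct_le a b a' b' : a \in B -> b \in B -> a' \in B -> b' \in B ->
  a != a' ->
  `|inner a b a' b'| <= 2 * w%:R ^+ 2 / (gap a a')%:R *
     ((`|position a b first - position a' b' first| < w%:Z)%R +
      (`|position a b last - position a' b' last| < w%:Z)%R)%:R.
Proof.
wlog aa' : a b a' b' / (a' < a)%N => [H|].
  move=> aB bB a'B b'B aa'; case: (ltngtP a a') (aa') => // lt _; last exact: H.
  have := H _ _ _ _ lt a'B b'B aB bB; rewrite eq_sym aa' innerC => /(_ isT).
  by rewrite /gap addnC (distrC (position a' b' first)) (distrC (position a' b' last)).
move=> aB bB a'B b'B _; rewrite inner_correlation//.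
have /andP[na na2] := B_range aB; have /andP[na' na'2] := B_range a'B.
pose h := (a - a')%N.
have h0 : (0 < h)%N by rewrite subn_gt0.
have hL : (h %| L)%N by apply: L_dvd; rewrite /h; lia.
have hq : (h %| q)%N by rewrite dvdn_mulr.
pose m := (q %/ h)%N; have mh : (m * h = q)%N by rewrite divnK.
pose s : int := a'%:Z * (L * b')%:Z - a%:Z * (L * b)%:Z.
have E x : position a b x - position a' b' x = h%:Z * x%:Z + s.
  by rewrite /position /s /h -subzn 1?ltnW//; ring.
under eq_bigr => x _ do rewrite E.
rewrite !E -mh /w -mh.
have fl : (first <= last)%N by rewrite /first /last; apply: leq_mul => //; lia.
apply: le_trans (@sum_correlation_le _ m W h _ _ s h0 fl) _.
rewrite natrM ler_wpM2r// /gap (_ : (a' - a = 0)%N) ?addn0 -/h; last by lia.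
rewrite ler_pdivlMr ?ltr0n// -!natrX -!natrM ler_nat.
by rewrite leq_eqVlt; apply/orP; left; apply/eqP; ring.
Qed.

(* The harmonic number of index n + 1. *)
Definition harmonic : R := \sum_(0 <= j < n.+1) (j.+1%:R)^-1.

(** The slopes [a'] are binned by [j a']. A bin holds at most [k] of them on either side of [a].
    Adding [W <= k * gap] to [j * W <= gap] gives [(j + 1) * W <= (k + 1) * gap], which also covers
    the bin [j = 0]. *)
Lemma sum_gap_le a : a \in B ->
  \sum_(a' <- B | a' != a) ((gap a a')%:R)^-1 <=
  (2 * k * k.+1)%:R / W%:R * harmonic.
Proof.
move=> aB; pose j a' := (gap a a' %/ W)%N.
have le1 a' : a' \in B -> a' != a ->
    ((gap a a')%:R)^-1 <= k.+1%:R / W%:R * ((j a').+1%:R)^-1 :> R.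
  move=> a'B aa'; have g0 : (0 < gap a a')%N by rewrite /gap; move: aa'; lia.
  rewrite -mulrA -invfM -natrM -[leLHS]mul1r ler_pdivrMr ?ltr0n//.
  rewrite mulrAC ler_pdivlMr ?ltr0n ?muln_gt0 ?W_gt0// mul1r -natrM ler_nat.
  have H : (W <= k * gap a a')%N.
    have [lt|lt|eq] := ltngtP a' a.
    - have := B_separated a'B aB lt; rewrite /gap; lia.
    - have := B_separated aB a'B lt; rewrite /gap; lia.
    - by rewrite eq eqxx in aa'.
  by have := leq_trunc_div (gap a a') W; rewrite -/(j a'); lia.
have jn a' : a' \in B -> (j a' < n.+1)%N.
  move=> a'B; rewrite ltnS; apply: leq_trans (leq_div _ _) _.
  have := B_range aB; have := B_range a'B; rewrite /gap; lia.
have cnt i : (count (fun a' => j a' == i) B <= k * 2)%N.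
  rewrite -size_filter -(count_predC (ltn^~ a)) muln2 -addnn.
  rewrite !count_filter; apply: leq_add; rewrite -[leqRHS]muln1.
    apply: count_separated => // x y xB yB /= /andP[xa /eqP jx] /andP[ya /eqP jy] xy.
    have := divn_eq (gap a x) W; have := divn_eq (gap a y) W.
    have := ltn_pmod (gap a x) W_gt0; have := ltn_pmod (gap a y) W_gt0.
    rewrite -/(j x) -/(j y) jx jy /gap; move: xa ya; lia.
  apply: count_separated => // x y xB yB /= /andP[xa /eqP jx] /andP[ya /eqP jy] xy.
  have := divn_eq (gap a x) W; have := divn_eq (gap a y) W.
  have := ltn_pmod (gap a x) W_gt0; have := ltn_pmod (gap a y) W_gt0.
  rewrite -/(j x) -/(j y) jx jy /gap; move: xa ya; lia.
apply: (@le_trans _ _ (\sum_(a' <- B) \sum_(0 <= i < n.+1)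
    k.+1%:R / W%:R * i.+1%:R^-1 * (j a' == i)%:R)).
  rewrite big_mkcond /= !big_seq; apply: ler_sum => a' a'B.
  rewrite (bigD1_seq (j a')) ?mem_index_iota ?iota_uniq ?jn//= eqxx mulr1.
  apply: ler_wpDr.
    by apply: sumr_ge0 => i _; rewrite !mulr_ge0// ?invr_ge0.
  by case: ifPn => [|_]; [exact: le1|rewrite !mulr_ge0// ?invr_ge0].
rewrite exchange_big /= /harmonic mulr_sumr; apply: ler_sum => i _.
rewrite -mulr_sumr -natr_sum.
have -> : (2 * k * k.+1)%:R / W%:R / i.+1%:R = k.+1%:R / W%:R / i.+1%:R * (k * 2)%:R :> R.
  by rewrite !natrM; ring.
rewrite ler_wpM2l ?mulr_ge0 ?invr_ge0// ler_nat; apply: leq_trans (cnt i).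
by rewrite -sum1_count [leqRHS]big_mkcond.
Qed.

Lemma sum_tube_mul (g : nat -> nat -> R) :
  \sum_(first <= x < last) \sum_(0 <= e < height) tube_sum x e * g x e =
  \sum_(a <- B) \sum_(b <- B) \sum_(first <= x < last) \sum_(0 <= e < height)
    kernel R q W (e%:Z - position a b x) * g x e.
Proof.
under eq_bigr => x _.
  under eq_bigr => e _.
    rewrite mulr_suml; under eq_bigr => a _ do rewrite mulr_suml.
    over.
  rewrite exchange_big /=; under eq_bigr => a _ do rewrite exchange_big /=.
  over.
by rewrite exchange_big /=; apply: eq_bigr => a _; rewrite exchange_big.
Qed.

(** The square is expanded into pairs of tubes, with [(a, b)] fixed. Slope [a] itself gives [2 * k]
    overlaps of size [2 * w * W] in each of at most [3 * q] columns. Another slope gives at most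
    [2 * k] tubes near each end of the range, and the gaps are then summed harmonically. *)
Lemma energy_le :
  \sum_(first <= x < last) \sum_(0 <= e < height) tube_sum x e ^+ 2 <=
  (size B)%:R ^+ 2 * w%:R ^+ 2 *
    ((12 * k)%:R + (16 * k ^ 2 * k.+1)%:R * harmonic / W%:R).
Proof.
set Z := (X in _ * X).
rewrite sum_tube_mul.
apply: (@le_trans _ _ (\sum_(a <- B) \sum_(b <- B) w%:R ^+ 2 * Z)); last first.
  rewrite -mulrA; move: (w%:R ^+ 2 * Z) => z.
  by rewrite !big_const_seq !count_predT !iter_addr_0 -mulrnA mulnn -natrX mulr_natl.
rewrite !big_seq; apply: ler_sum => a aB; rewrite !big_seq; apply: ler_sum => b bB.
under eq_bigr => x _ do under eq_bigr => e _ do rewrite mulrC.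
rewrite sum_tube_mul.
under eq_bigr => a' _ do under eq_bigr => b' _ do rewrite -/(inner a' b' a b) innerC.
rewrite (bigD1_seq a)//= [leRHS]mulrDr; apply: lerD.
  apply: (@le_trans _ _ (\sum_(b' <- B) \sum_(first <= x < last)
     (2 * w * W * (`|position a b x - position a b' x| < w%:Z)%R)%:R)).
    rewrite !big_seq; apply: ler_sum => b' b'B.
    by apply: le_trans (ler_norm _) _; apply: inner_same_le.
  rewrite exchange_big /=.
  apply: (@le_trans _ _ (\sum_(first <= x < last) (2 * w * W * (k * 2))%:R)).
    apply: ler_sum => x _; rewrite -natr_sum ler_nat -big_distrr /= leq_mul2l.
    apply/orP; right; apply: leq_trans (count_position x (position a b x) aB).
    by rewrite -sum1_count [leqRHS]big_mkcond.
  rewrite sumr_const_nat -natrX -natrM -mulrnA ler_nat.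
  have H : (last - first <= 3 * q)%N by rewrite /last /first /q; nia.
  apply: leq_trans (leq_mul (leqnn _) H) _.
  by rewrite leq_eqVlt; apply/orP; left; apply/eqP; rewrite /w; ring.
apply: (@le_trans _ _ (\sum_(a' <- B | a' != a) (8 * k)%:R * w%:R ^+ 2 / (gap a a')%:R)).
  rewrite big_seq_cond [leRHS]big_seq_cond; apply: ler_sum => a' /andP[a'B aa'].
  apply: (@le_trans _ _ (\sum_(b' <- B) 2 * w%:R ^+ 2 / (gap a a')%:R *
     ((`|position a b first - position a' b' first| < w%:Z)%R +
      (`|position a b last - position a' b' last| < w%:Z)%R)%:R)).
    rewrite !big_seq; apply: ler_sum => b' b'B.
    by apply: le_trans (ler_norm _) _; apply: inner_distinct_le => //; rewrite eq_sym.
  rewrite -mulr_sumr -natr_sum.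
  have -> : (8 * k)%:R * w%:R ^+ 2 / (gap a a')%:R =
      2 * w%:R ^+ 2 / (gap a a')%:R * (4 * k)%:R :> R.
    by rewrite !natrM; ring.
  rewrite ler_wpM2l ?mulr_ge0 ?invr_ge0// ler_nat big_split /=.
  rewrite (_ : 4 * k = k * 2 + k * 2)%N; last by lia.
  by apply: leq_add; [apply: leq_trans (count_position first (position a b first) a'B)
    |apply: leq_trans (count_position last (position a b last) a'B)];
    rewrite -sum1_count [leqRHS]big_mkcond.
rewrite -mulr_sumr.
apply: le_trans (ler_wpM2l _ (sum_gap_le aB)) _; first by rewrite mulr_ge0// exprn_ge0.
by rewrite le_eqVlt; apply/orP; left; apply/eqP; rewrite !natrM; ring.
Qed.

Definition narrow (x e : nat) : R :=
  \sum_(a <- B) \sum_(b <- B) window R q (e%:Z - position a b x).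

Definition wide (x e : nat) : R :=
  \sum_(a <- B) \sum_(b <- B) window R w (e%:Z - position a b x).

Lemma tube_sumE x e : tube_sum x e = W%:R * narrow x e - wide x e.
Proof.
rewrite /narrow /wide mulr_sumr -sumrB; apply: eq_bigr => a _.
by rewrite mulr_sumr -sumrB.
Qed.

Lemma wide_le x e : wide x e <= (size B * (k * 2))%:R.
Proof.
apply: (@le_trans _ _ (\sum_(a <- B) (k * 2)%:R)).
  rewrite /wide !big_seq; apply: ler_sum => a aB.
  rewrite -natr_sum ler_nat; apply: leq_trans (count_position x e%:Z aB).
  rewrite -sum1_count [leqRHS]big_mkcond; apply: leq_sum => b _.
  by case: ifP => //; case: andP => // -[]; lia.
by rewrite big_const_seq count_predT iter_addr_0 -mulrnA mulnC.
Qed.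

(** The error [F = tube_sum x e] is made quadratic by [F <= tau / 2 + F ^ 2 / (2 * tau)], so that
    the energy bound applies to it; [tau] is chosen later. *)
Lemma narrow_pointwise (tau : R) x e : 0 < tau ->
  W%:R * narrow x e <=
  (size B * (k * 2))%:R + tau / 2 + tube_sum x e ^+ 2 / (2 * tau).
Proof.
move=> tau0; rewrite (_ : W%:R * narrow x e = wide x e + tube_sum x e).
  rewrite -addrA; apply: lerD (wide_le _ _) _.
  rewrite -subr_ge0; set F := tube_sum x e.
  have -> : tau / 2 + F ^+ 2 / (2 * tau) - F = (F - tau) ^+ 2 / (2 * tau).
    by field; rewrite ?gt_eqF.
  by rewrite divr_ge0 ?sqr_ge0 ?mulr_ge0// ltW.
by rewrite tube_sumE; ring.
Qed.

(** * Incidences with sums and approximate products *)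

Variables X M : seq nat.
Hypothesis X_uniq : uniq X.
Hypothesis X_range : forall x, x \in X -> (2 * n <= x <= 4 * n)%N.
Hypothesis X_sum : forall b c, b \in B -> c \in B -> (b + c)%N \in X.
(** Products are needed only up to [n]: after scaling by the square of delta, a distance [n] becomes
    about delta. *)
Hypothesis M_prod : forall a c, a \in B -> c \in B ->
  exists2 m, m \in M & (a * c <= m + n)%N && (m <= a * c + n)%N.

(** The product [m] sits at height [L * m]. The margins cover the error [n] of the net ([q] either
    way), the rise [a * i <= 2 * q] of a tube across the [L] columns, and the thickness [q]. *)
Definition near_product (e : nat) : bool :=
  has (fun m => (L * m <= e + q) && (e < L * m + 4 * q))%N M.

Lemma sum_uniq_subset (s1 s2 : seq nat) (g : nat -> R) : uniq s1 -> uniq s2 ->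
  {subset s1 <= s2} -> (forall x, 0 <= g x) ->
  \sum_(x <- s1) g x <= \sum_(x <- s2) g x.
Proof.
move=> u1 u2 s12 g0; have P : perm_eq s1 [seq x <- s2 | x \in s1].
  apply: uniq_perm => //; first exact: filter_uniq.
  by move=> x; rewrite mem_filter; case: (boolP (x \in s1)) => // /s12 ->.
by rewrite (perm_big _ P) big_filter big_mkcond /=; apply: ler_sum => x _; case: ifP.
Qed.

Lemma column_range x i : x \in X -> (i < L)%N -> (first <= x * L + i < last)%N.
Proof. by move=> /X_range /andP[x1 x2] iL; rewrite /first /last; nia. Qed.

Lemma sum_columns_le (g : nat -> R) : (forall x, 0 <= g x) ->
  \sum_(x <- X) \sum_(0 <= i < L) g (x * L + i)%N <= \sum_(first <= x < last) g x.
Proof.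
move=> g0; rewrite -(big_allpairs_dep (h := fun x i => (x * L + i)%N)
  (r1 := X) (r2 := fun=> index_iota 0 L)).
apply: sum_uniq_subset => //; first last.
- move=> z /allpairsP[[x i] /= [xX]]; rewrite !mem_index_iota => /andP[_ iL] ->.
  exact: column_range.
- exact: iota_uniq.
apply: allpairs_uniq => //; first exact: iota_uniq.
move=> [x i] [y j] /allpairsP[[x' i'] /= [_ ii' [-> ->]]] /allpairsP[[y' j'] /= [_ jj' [-> ->]]] E.
move: ii' jj'; rewrite !mem_index_iota => /andP[_ ii] /andP[_ jj].
have := congr1 (divn^~ L) E; rewrite /= !divnMDl// !divn_small// !addn0 => xy.
by move: E; rewrite xy => /addnI ->.
Qed.

Lemma count_near_product : \sum_(0 <= e < height | near_product e) (1 : R) <= (size M * (5 * q))%:R.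
Proof.
apply: (@le_trans _ _ (\sum_(0 <= e < height) \sum_(m <- M)
    ((L * m <= e + q) && (e < L * m + 4 * q))%N%:R)).
  rewrite big_mkcond; apply: ler_sum => e _.
  case: ifPn => [/hasP[m mM H]|_]; last by apply: sumr_ge0.
  rewrite (big_rem m)//= H lerDl; exact: sumr_ge0.
rewrite exchange_big /=.
apply: (@le_trans _ _ (\sum_(m <- M) (5 * q)%:R)); last first.
  by rewrite big_const_seq count_predT iter_addr_0 -mulrnA mulnC.
apply: ler_sum => m _; rewrite -natr_sum ler_nat.
rewrite -[leqRHS](size_iota (L * m - q)); pose p e := ((L * m <= e + q) && (e < L * m + 4 * q))%N.
apply: (@leq_trans (size [seq e <- index_iota 0 height | p e])).
  by rewrite size_filter -sum1_count [leqRHS]big_mkcond.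
apply: uniq_leq_size; first by rewrite filter_uniq// iota_uniq.
by move=> e; rewrite mem_filter mem_iota /p; lia.
Qed.

(** Since [(b + c) - b = c], the tube passes at height [a * c * L + a * i], whatever [b] is. Its
    whole cross-section of [q] cells therefore lies near a product. *)
Lemma tube_column_sum a b c i : a \in B -> b \in B -> c \in B -> (i < L)%N ->
  \sum_(0 <= e < height | near_product e)
    window R q (e%:Z - position a b ((b + c) * L + i)) = q%:R.
Proof.
move=> aB bB cB iL; set p := position _ _ _.
have [p0 pw] := position_range aB bB (column_range (X_sum bB cB) iL).
have pE : p = (a * c * L + a * i)%:Z.
  by rewrite /p /position !(PoszD, PoszM); ring.
transitivity (\sum_(0 <= e < height) window R q (e%:Z - p)).
  rewrite big_mkcond; apply: eq_bigr => e _; case: ifPn => // ne.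
  rewrite /window; case: andP => // -[]; rewrite pE => pe ep.
  case/negP: ne; apply/hasP; have [m mM /andP[m1 m2]] := M_prod aB cB; exists m => //.
  have /andP[_ a2] := B_range aB.
  have : (a * i <= 2 * q)%N by rewrite /q; nia.
  have : (L * m <= L * (a * c + n))%N by rewrite leq_mul2l m2 orbT.
  have : (L * (a * c) <= L * (m + n))%N by rewrite leq_mul2l m1 orbT.
  rewrite !mulnDr -/q => H1 H2 H3.
  by rewrite mulnC in pe ep; lia.
have qw : (q <= w)%N by rewrite leq_pmulr.
rewrite (@sum_shift _ (window R q) q)//; first last.
- by apply: le_trans pw; rewrite lerD2l.
- by move=> v /negbTE H; rewrite /window H.
rewrite big_nat (eq_bigr (fun=> 1)) => [|u]; first by rewrite -big_nat sumr_const_nat subn0.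
by rewrite /window => /= uq; rewrite ltz_nat uq.
Qed.

(** These are the incidences of the triples [(a, b, c)], each worth [L * q] cells. For fixed [a] and
    [b] the sums [b + c] are distinct members of [X]; the other columns contribute nonnegatively. *)
Lemma narrow_sum_ge :
  (size B ^ 3 * L * q)%:R <=
  \sum_(x <- X) \sum_(0 <= i < L) \sum_(0 <= e < height | near_product e)
     narrow (x * L + i) e.
Proof.
rewrite /narrow.
under eq_bigr => x _ do under eq_bigr => i _ do rewrite exchange_big /=.
under eq_bigr => x _ do rewrite exchange_big /=.
rewrite exchange_big /=.
apply: (@le_trans _ _ (\sum_(a <- B) \sum_(b <- B) (size B * (L * q))%:R)).
  rewrite !big_const_seq !count_predT !iter_addr_0 -!mulrnA ler_nat.
  by rewrite leq_eqVlt; apply/orP; left; apply/eqP; ring.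
rewrite !big_seq; apply: ler_sum => a aB.
under [leRHS]eq_bigr => x _ do under eq_bigr => i _ do rewrite exchange_big /=.
under [leRHS]eq_bigr => x _ do rewrite exchange_big /=.
rewrite exchange_big /= !big_seq; apply: ler_sum => b bB.
pose G x := \sum_(0 <= i < L) \sum_(0 <= e < height | near_product e)
  window R q (e%:Z - position a b (x * L + i)).
apply: (@le_trans _ _ (\sum_(x <- map (addn b) B) G x)).
  rewrite big_map big_seq.
  apply: (@le_trans _ _ (\sum_(c <- B | c \in B) (L * q)%:R)).
    by rewrite -big_seq big_const_seq count_predT iter_addr_0 -mulrnA mulnC.
  apply: ler_sum => c cB; rewrite /G.
  under eq_big_nat => i iL do rewrite tube_column_sum//.
  by rewrite sumr_const_nat subn0 -mulrnA mulnC.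
apply: sum_uniq_subset => //.
- by rewrite map_inj_uniq//; exact: addnI.
- by move=> _ /mapP[c cB ->]; apply: X_sum.
- by move=> x; do 2 apply: sumr_ge0 => *; rewrite /window.
Qed.

(** The pointwise bound is summed over the columns of [X] and the rows near products, against the
    lower bound for incidences. The quadratic error is enlarged to all columns and rows, where
    [energy_le] controls it. *)
Lemma incidence_le (lambda : R) : (0 < size B)%N -> 0 < lambda ->
  ((size B) ^ 2 * W)%:R <=
  5 * ((2 * k)%:R + lambda / 2) * (size X * size M)%:R +
  (n * W ^ 2)%:R * ((12 * k)%:R + (16 * k ^ 2 * k.+1)%:R * harmonic / W%:R) / (2 * lambda).
Proof.
move=> B0 l0; set Z := (12 * k)%:R + _.
have en := energy_le; rewrite -/Z in en; move: en; move: Z => Z en.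
set N := size B in B0 en *.
have N0 : 0 < N%:R :> R by rewrite ltr0n.
(* This makes [tau] comparable to the bound on [wide], which is also linear in [N]; a common factor
   [N * L * q] then cancels. *)
pose tau := lambda * N%:R; have tau0 : 0 < tau by rewrite mulr_gt0.
have key : W%:R * (N ^ 3 * L * q)%:R <=
    ((N * (k * 2))%:R + tau / 2) * (size X * L * (size M * (5 * q)))%:R +
    N%:R ^+ 2 * w%:R ^+ 2 * Z / (2 * tau).
  apply: le_trans (ler_wpM2l _ narrow_sum_ge) _ => //.
  rewrite mulr_sumr.
  under eq_bigr => x _ do [rewrite mulr_sumr; under eq_bigr => i _ do rewrite mulr_sumr].
  pose c := (N * (k * 2))%:R + tau / 2.
  pose g x := \sum_(0 <= e < height) tube_sum x e ^+ 2 / (2 * tau).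
  apply: (@le_trans _ _ (\sum_(x <- X) \sum_(0 <= i < L)
      (c * (size M * (5 * q))%:R + g (x * L + i)%N))).
    apply: ler_sum => x _; apply: ler_sum => i _.
    apply: (@le_trans _ _ (\sum_(0 <= e < height | near_product e)
      (c * 1 + tube_sum (x * L + i) e ^+ 2 / (2 * tau)))).
      by apply: ler_sum => e _; rewrite mulr1; apply: narrow_pointwise.
    rewrite big_split /= -mulr_sumr; apply: lerD.
      rewrite ler_wpM2l ?count_near_product// addr_ge0//.
      by rewrite divr_ge0// ltW.
    rewrite /g big_mkcond; apply: ler_sum => e _; case: ifP => // _.
    by rewrite divr_ge0 ?sqr_ge0// mulr_ge0// ltW.
  under eq_bigr => x _ do rewrite big_split sumr_const_nat subn0 /=.
  rewrite big_split /= big_const_seq count_predT iter_addr_0; apply: lerD.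
    rewrite -!mulrnAr -!mulrnA le_eqVlt; apply/orP; left; apply/eqP.
    by congr (_ * _%:R); ring.
  apply: le_trans (sum_columns_le _) _.
    by move=> x; apply: sumr_ge0 => e _; rewrite divr_ge0 ?sqr_ge0// mulr_ge0// ltW.
  rewrite /g; under eq_bigr => x _ do rewrite -mulr_suml.
  by rewrite -mulr_suml ler_wpM2r// invr_ge0 mulr_ge0// ltW.
have L0 : 0 < L%:R :> R by rewrite ltr0n.
have n0 : 0 < n%:R :> R by rewrite ltr0n.
have D0 : 0 < N%:R * L%:R * q%:R :> R by rewrite /q natrM !mulr_gt0.
rewrite -(ler_pM2r D0); apply: le_trans (le_trans _ key) _.
  by rewrite le_eqVlt; apply/orP; left; apply/eqP; rewrite !natrM ?natrX; ring.
rewrite le_eqVlt; apply/orP; left; apply/eqP; rewrite /tau /w /q !natrM ?natrX.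
by field; rewrite !gt_eqF.
Qed.

Lemma card_sum_product_le : (0 < size B)%N ->
  (size B ^ 2 * W)%:R <=
  (size X * size M)%:R * (20 * k%:R + 5 * n%:R / (size B)%:R ^+ 2 *
    ((12 * k * W)%:R + (16 * k ^ 2 * k.+1)%:R * harmonic)).
Proof.
move=> B0; have := @incidence_le; set Z := (12 * k)%:R + _.
have WZ : (12 * k * W)%:R + (16 * k ^ 2 * k.+1)%:R * harmonic = W%:R * Z.
  by rewrite /Z natrM; field; rewrite pnatr_eq0 -lt0n.
have Z0 : 0 < Z.
  rewrite ltr_wpDr ?ltr0n ?muln_gt0//.
  by rewrite divr_ge0// mulr_ge0//; apply: sumr_ge0 => j _; rewrite invr_ge0.
rewrite WZ; move: Z Z0 {WZ} => Z Z0 H.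
have N0 : 0 < (size B)%:R :> R by rewrite ltr0n.
have n0 : 0 < n%:R :> R by rewrite ltr0n.
have W0 : 0 < W%:R :> R by rewrite ltr0n.
(* This lambda makes the energy term of [incidence_le] half of the left-hand side. *)
pose lambda := n%:R * W%:R * Z / (size B)%:R ^+ 2.
have l0 : 0 < lambda by rewrite divr_gt0 ?mulr_gt0 ?exprn_gt0.
have {H} := H _ B0 l0.
have -> : (n * W ^ 2)%:R * Z / (2 * lambda) = (size B ^ 2 * W)%:R / 2.
  by rewrite /lambda !natrM ?natrX; field; rewrite !gt_eqF.
have -> : 5 * n%:R / (size B)%:R ^+ 2 * (W%:R * Z) = 5 * lambda.
  by rewrite /lambda; field; rewrite gt_eqF.
by rewrite natrM; set P := (_ * _)%:R; lra.
Qed.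

End energy.

(** * Logarithmic estimates, nets and packing numbers *)

Lemma harmonic_le (R : realType) n : harmonic R n <= 1 + ln n.+1%:R.
Proof.
rewrite /harmonic; elim: n => [|n IHn]; first by rewrite big_nat1 invr1 ln1 addr0.
rewrite big_nat_recr//=; apply: le_trans (lerD IHn (lexx _)) _.
rewrite -addrA lerD2l -lerBrDl.
have n2 : 0 < n.+2%:R :> R by rewrite ltr0n.
have n1 : 0 < n.+1%:R :> R by rewrite ltr0n.
have E : 1 + - n.+2%:R^-1 = n.+1%:R / n.+2%:R :> R.
  rewrite (_ : n.+1%:R = n.+2%:R - 1); last by rewrite -[n.+2%:R]natr1 addrK.
  by rewrite mulrBl divff ?gt_eqF// mul1r.
(* The inequality [ln (1 + x) <= x] at [x = - 1 / (n + 2)] bounds the new term by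
   [ln (n + 2) - ln (n + 1)]. *)
have := @le_ln1Dx R (- n.+2%:R^-1).
rewrite E ltrN2 invf_lt1// ltr1n => /(_ isT).
by rewrite ln_div ?posrE// -[X in _ -> _ <= X]opprB lerNr.
Qed.

Lemma exists_natceil (R : realType) (x : R) : 1 <= x ->
  exists n : nat, [/\ (0 < n)%N, x <= n%:R, n%:R <= 2 * x &
    forall m : nat, x <= m%:R -> (n <= m)%N].
Proof.
move=> x1.
have ex : exists m : nat, x <= m%:R.
  by exists (Num.bound x); apply/ltW/archi_boundP; lra.
exists (ex_minn ex); case: ex_minnP => -[|m] xm mmin.
  by have := le_trans x1 xm; rewrite ler10.
split => //; rewrite leNgt; apply/negP => H.
have : (m.+1 <= m)%N by apply: mmin; move: H; rewrite -natr1; lra.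
by rewrite ltnn.
Qed.

(** Greedy choice: an element joins [M] only when it is related to no member so far. Separation will
    bound the packing number below, and the net property will supply [M_prod]. *)
Lemma exists_separated_net (T : eqType) (r : rel T) (s : seq T) :
  reflexive r -> symmetric r ->
  exists M, [/\ uniq M, {subset M <= s},
    forall x y, x \in M -> y \in M -> x != y -> ~~ r x y &
    forall x, x \in s -> exists2 m, m \in M & r x m].
Proof.
move=> rr rs; elim: s => [|x s [M [uM Ms Msep Mnet]]].
  by exists [::]; split.
have [/hasP[m mM xm]|/hasPn xM] := boolP (has (r x) M).
  exists M; split => //; first by move=> y /Ms ys; rewrite in_cons ys orbT.
  by move=> y; rewrite in_cons => /predU1P[->|/Mnet//]; exists m.
exists (x :: M); split.
- by rewrite /= uM andbT; apply/negP => /xM; rewrite rr.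
- by move=> y; rewrite !in_cons => /predU1P[->|/Ms ->]; rewrite ?eqxx ?orbT.
- move=> y z; rewrite !in_cons => /predU1P[->|yM] /predU1P[->|zM].
  + by rewrite eqxx.
  + by move=> _; apply: xM.
  + by move=> _; rewrite rs; apply: xM.
  + exact: Msep.
- move=> y; rewrite in_cons => /predU1P[->|/Mnet[m mM ym]].
    by exists x; rewrite ?mem_head.
  by exists m; rewrite // in_cons mM orbT.
Qed.

Lemma size_le_packing_number (R : realType) (S : set R) (delta : R) (s : seq R) :
  uniq s -> (forall x, x \in s -> S x) ->
  (forall x y, x \in s -> y \in s -> x != y -> delta <= `|x - y|) ->
  ((size s)%:R%:E <= packing_number S delta)%E.
Proof.
move=> us sS sep; apply: ereal_sup_ubound; exists [fset x in s]%fset.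
  split; first by move=> x /=; rewrite in_fset; apply: sS.
  by move=> x y /=; rewrite !in_fset => xs ys /eqP; apply: sep.
by rewrite card_fseq undup_id.
Qed.

(** The scale [t] will be [delta] for sums and [delta ^+ 2] for products. *)
Lemma size_le_packing_multiples (R : realType) (S : set R) (delta t : R) (s : seq nat) :
  0 < t -> uniq s -> (forall x, x \in s -> S (t * x%:R)) ->
  (forall x y, x \in s -> y \in s -> x != y -> delta / t <= `|x%:R - y%:R|) ->
  ((size s)%:R%:E <= packing_number S delta)%E.
Proof.
move=> t0 us sS sep.
have inj : injective (fun x : nat => t * x%:R).
  by move=> x y /(mulfI (lt0r_neq0 t0)) /eqP; rewrite eqr_nat => /eqP.
rewrite -(size_map (fun x : nat => t * x%:R)); apply: size_le_packing_number.
- by rewrite map_inj_uniq.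
- by move=> _ /mapP[x xs ->]; apply: sS.
- move=> _ _ /mapP[x xs ->] /mapP[y ys ->] xy.
  rewrite -mulrBr normrM (gtr0_norm t0) mulrC -ler_pdivrMr//; apply: sep => //.
  by apply: contra_neq xy => ->.
Qed.

(** The logarithm is absorbed by a power: with [y] the square root of [N], the harmonic sum is at
    most [1 + ln 4 + 3 * ln y <= 8 * y], while [n <= 2 * y ^ 3]. *)
Lemma mul_harmonic_le (R : realType) (N : R) (n : nat) : 1 <= N -> (0 < n)%N ->
  n%:R <= 2 * N `^ (3 / 2) -> n%:R * harmonic R n <= 16 * N ^+ 2.
Proof.
move=> N1 n0 nN; pose y := N `^ 2^-1.
have Nge0 : 0 <= N by lra.
have y1 : 1 <= y.
  by rewrite -[leLHS](powRr0 N) ler_powR// invr_ge0.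
have y2 : y ^+ 2 = N by rewrite -powR_mulrn ?powR_ge0// /y -powRrM mulVf// powRr1.
have y3 : N `^ (3 / 2) = y ^+ 3 by rewrite -powR_mulrn ?powR_ge0// /y -powRrM mulrC.
rewrite -y2; rewrite y3 in nN.
have y0 : 0 < y by lra.
have y30 : 0 < y ^+ 3 by rewrite exprn_gt0.
have n1 : n.+1%:R <= 4 * y ^+ 3.
  rewrite -natr1; have : 1 <= n%:R :> R by rewrite ler1n.
  by lra.
have H8 : harmonic R n <= 8 * y.
  apply: le_trans (harmonic_le R n) _.
  have : ln n.+1%:R <= ln (4 * y ^+ 3) by rewrite ler_ln ?posrE ?ltr0n//; lra.
  rewrite lnM ?posrE// lnXn// -mulr_natl.
  have := ln_sublinear y0; have := @ln_sublinear R 4; lra.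
have h0 : 0 <= harmonic R n by apply: sumr_ge0 => j _; rewrite invr_ge0.
apply: le_trans (ler_pM _ h0 nN H8) _ => //.
by rewrite le_eqVlt; apply/orP; left; apply/eqP; ring.
Qed.

(** * The estimate for integer sets and its transfer to the reals *)

Lemma integer_sum_product (R : realType) (alpha : R) (N n W k : nat) (B X M : seq nat) :
  1 < alpha -> alpha <= 3 / 2 -> (0 < N)%N -> size B = N ->
  N%:R `^ alpha <= n%:R -> n%:R <= 2 * N%:R `^ alpha ->
  N%:R `^ (alpha - 1) <= W%:R -> W%:R <= 2 * N%:R `^ (alpha - 1) ->
  (0 < k)%N -> uniq B ->
  (forall b, b \in B -> n <= b <= 2 * n)%N ->
  (forall x y, x \in B -> y \in B -> x < y -> W <= k * (y - x))%N ->
  uniq X ->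
  (forall x, x \in X -> 2 * n <= x <= 4 * n)%N ->
  (forall b c, b \in B -> c \in B -> (b + c)%N \in X) ->
  (forall a c, a \in B -> c \in B ->
    exists2 m, m \in M & (a * c <= m + n)%N && (m <= a * c + n)%N) ->
  N%:R `^ (1 + alpha) <= (size X * size M)%:R * (260 * k%:R + 1280 * (k ^ 2 * k.+1)%:R).
Proof.
move=> a1 a2 N0 BN nl nu Wl Wu k0 uB Br Bs uX Xr Xs Mp.
have N1 : 1 <= N%:R :> R by rewrite ler1n.
have Npos : 0 < N%:R :> R by rewrite ltr0n.
have Qpos (t : R) : 0 < N%:R `^ t by rewrite powR_gt0.
have powND (s t : R) : N%:R `^ (s + t) = N%:R `^ s * N%:R `^ t.
  by rewrite powRD// [_ != 0]lt0r_neq0// implybT.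
have n0 : (0 < n)%N by rewrite -(ltr_nat R); apply: lt_le_trans nl.
have W0 : (0 < W)%N by rewrite -(ltr_nat R); apply: lt_le_trans Wl.
(* The refinement is [L = n!], a multiple of every possible difference of slopes. *)
have Ldvd h : (0 < h <= n)%N -> (h %| n`!)%N by move=> ?; apply: dvdn_fact.
have := @card_sum_product_le R B n W k n`! n0 W0 k0 (fact_gt0 n) Ldvd uB Br Bs X M uX Xr Xs Mp.
rewrite BN => /(_ N0).
have PW : N%:R `^ (1 + alpha) <= (N ^ 2 * W)%:R.
  rewrite (_ : 1 + alpha = 2%:R + (alpha - 1)); last by ring.
  by rewrite powND powR_mulrn ?ler0n// natrM natrX ler_wpM2l// exprn_ge0.
move/(le_trans PW)/le_trans; apply; rewrite ler_wpM2l//.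
(* The product is at most [4 * N ^ (2 * alpha - 1)], and [alpha <= 3 / 2] makes the exponent at most
   2. *)
have nW : n%:R * W%:R <= 4 * N%:R ^+ 2 :> R.
  apply: le_trans (ler_pM _ _ nu Wu) _ => //.
  rewrite mulrACA -powND -powR_mulrn ?ler0n//.
  by apply: ler_pM; rewrite ?mulr_ge0 ?powR_ge0 ?ler_powR//; lra.
have nH : n%:R * harmonic R n <= 16 * N%:R ^+ 2.
  apply: mul_harmonic_le => //; apply: le_trans nu _.
  by rewrite ler_wpM2l// ler_powR.
have K : 5 * n%:R / N%:R ^+ 2 * ((12 * k * W)%:R + (16 * k ^ 2 * k.+1)%:R * harmonic R n) =
   (60 * k%:R * (n%:R * W%:R) + 80 * (k ^ 2 * k.+1)%:R * (n%:R * harmonic R n)) / N%:R ^+ 2.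
  by rewrite !natrM ?natrX; field; rewrite gt_eqF.
have N2 : 0 < N%:R ^+ 2 :> R by rewrite exprn_gt0.
rewrite K -lerBrDl ler_pdivrMr//.
have H1 : 60 * k%:R * (n%:R * W%:R) <= 60 * k%:R * (4 * N%:R ^+ 2) :> R by rewrite ler_wpM2l.
have H2 : 80 * (k ^ 2 * k.+1)%:R * (n%:R * harmonic R n) <=
    80 * (k ^ 2 * k.+1)%:R * (16 * N%:R ^+ 2).
  by rewrite ler_wpM2l.
apply: le_trans (lerD H1 H2) _.
by rewrite le_eqVlt; apply/orP; left; apply/eqP; ring.
Qed.

Lemma addn_range (n b d : nat) :
  (n <= b <= 2 * n -> n <= d <= 2 * n -> 2 * n <= b + d <= 4 * n)%N.
Proof. lia. Qed.

Lemma dist_nat_ge1 (R : realType) (x y : nat) : x != y -> 1 <= `|x%:R - y%:R| :> R.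
Proof.
by move=> xy; rewrite -[x%:R]/(x%:Z%:~R) -[y%:R]/(y%:Z%:~R) -intrB -intr_norm ler1z; lia.
Qed.

Lemma dist_nat_le (R : realType) (Q : R) (x y n : nat) :
  `|x%:R - y%:R| < Q -> Q <= n%:R -> (x <= y + n)%N && (y <= x + n)%N.
Proof.
by rewrite ltr_distl => /andP[l u] Qn; rewrite -!(ler_nat R) !natrD; apply/andP; split; lra.
Qed.

Theorem theorem4 (R : realType) (alpha c : R)
    (alpha_gt1 : 1 < alpha) (alpha_le : alpha <= 3 / 2) (c_gt0 : 0 < c)
    (eps : R) (eps_gt0 : 0 < eps) :
  exists2 C : R, 0 < C &
    forall (N : nat) (delta : R) (A : {fset R}),
      (1 <= N)%N ->
      delta = N%:R `^ (- alpha) ->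
      [set` A] `<=` `[1, 2] `&` multiples delta ->
      #|` A|%fset = N ->
      dist_separated (c * N%:R^-1) [set` A] ->
      ((C * N%:R `^ (1 + alpha - eps))%:E <=
         packing_number (sumset [set` A] [set` A]) delta *
         packing_number (productset [set` A] [set` A]) delta)%E.
Proof.
(* The factor 2 compensates for rounding: [W] may be twice [N ^ (alpha - 1)], while the indices are
   spaced by [c * N ^ (alpha - 1)]. *)
have [k [k0 ck]] : exists k : nat, (0 < k)%N /\ 2 <= k%:R * c.
  have [|k [k0 ck _ _]] := @exists_natceil R (1 + 2 / c).
    by rewrite lerDl divr_ge0// ltW.
  exists k; split=> //; rewrite -ler_pdivrMr//; lra.
pose K : R := 260 * k%:R + 1280 * (k ^ 2 * k.+1)%:R.
have K0 : 0 < K.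
  by apply: ltr_wpDr; [rewrite mulr_ge0 ?ler0n|rewrite mulr_gt0 ?ltr0n].
exists K^-1; first by rewrite invr_gt0.
move=> N delta A N1 deltaE AS AN Asep.
have N1' : 1 <= N%:R :> R by rewrite ler1n.
have Npos : 0 < N%:R :> R by rewrite ltr0n.
set Q := N%:R `^ alpha.
have Q0 : 0 < Q by rewrite powR_gt0.
have Q1 : 1 <= Q by rewrite -[leLHS](powRr0 N%:R) ler_powR//; lra.
have dE : delta = Q^-1 by rewrite deltaE powRN.
have d0 : 0 < delta by rewrite dE invr_gt0.
have QN : Q / N%:R = N%:R `^ (alpha - 1).
  by rewrite powRD ?(lt0r_neq0 Npos) ?implybT// powRN powRr1// ltW.
have QN1 : 1 <= N%:R `^ (alpha - 1) by rewrite -[leLHS](powRr0 N%:R) ler_powR//; lra.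
have [n [n0 nl nu nmin]] := exists_natceil Q1.
have [W [W0 Wl Wu _]] := exists_natceil QN1.
(* On [A] the truncation is exact, because [a * Q] is a nonnegative integer there. *)
pose idx (a : R) := Num.truncn (a * Q).
have idxE a : a \in A -> delta * (idx a)%:R = a.
  move=> /AS[/=]; rewrite in_itv /= => /andP[a1 a2] [z _ az].
  have zQ : z%:~R = a * Q by rewrite -az dE mulrAC mulVf ?mul1r// gt_eqF.
  have z0 : 0 <= z by rewrite -(ler0z R) zQ mulr_ge0 ?(le_trans ler01 a1)// ltW.
  case: z z0 zQ az => // z _ zQ az.
  by rewrite /idx -zQ natrK.
have idx_range a : a \in A -> Q <= (idx a)%:R <= 2 * Q.
  move=> aA; have [/=] := AS _ aA; rewrite in_itv /= -{1 2}(idxE _ aA) dE.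
  by rewrite mulrC ler_pdivlMr// ler_pdivrMr// mul1r => /andP[-> ->].
pose B := map idx A.
have memB x : x \in B -> exists2 a, a \in A & x = idx a by move=> /mapP.
have uB : uniq B.
  rewrite map_inj_in_uniq ?fset_uniq// => x y xA yA xy.
  by rewrite -(idxE _ xA) -(idxE _ yA) xy.
have Br b : b \in B -> (n <= b <= 2 * n)%N.
  move=> /memB[a aA ->]; have /andP[l u] := idx_range _ aA.
  (* An index is an integer at least [Q], so minimality of the ceiling [n] puts it above [n]. *)
  rewrite nmin//= -(ler_nat R) natrM; apply: le_trans u _.
  by rewrite ler_wpM2l.
have Bs x y : x \in B -> y \in B -> (x < y -> W <= k * (y - x))%N.
  move=> /memB[a aA ->] /memB[b bA ->] ab.
  have abne : a <> b by move=> E; rewrite E ltnn in ab.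
  have := Asep _ _ aA bA abne.
  rewrite -{1}(idxE _ aA) -{1}(idxE _ bA) -mulrBr normrM (gtr0_norm d0) distrC.
  rewrite -(natrB _ (ltnW ab)) normr_nat => H.
  rewrite -(ler_nat R) natrM; apply: le_trans Wu _; rewrite -QN.
  have H1 : c * (Q / N%:R) <= (idx b - idx a)%:R.
    by rewrite mulrCA -ler_pdivlMl// -dE.
  apply: le_trans (ler_wpM2l _ H1) => //; rewrite [leRHS]mulrA ler_wpM2r//.
  by rewrite QN powR_ge0.
pose X := undup [seq (b + c)%N | b <- B, c <- B].
have memX x : x \in X -> exists b c, [/\ b \in B, c \in B & x = (b + c)%N].
  by rewrite mem_undup => /allpairsP[[b d] /= [bB dB ->]]; exists b, d.
(* Integer products at distance [Q] are exactly delta apart after scaling by [delta ^+ 2], as [Q] is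
   the inverse of delta. *)
pose near (x y : nat) := `|x%:R - y%:R| < Q.
have near_refl : reflexive near by move=> x; rewrite /near subrr normr0.
have near_sym : symmetric near by move=> x y; rewrite /near distrC.
have [M [uM Ms Msep Mnet]] :=
  @exists_separated_net nat near [seq (b * c)%N | b <- B, c <- B] near_refl near_sym.
have key : N%:R `^ (1 + alpha) <= (size X * size M)%:R * K.
  apply: (@integer_sum_product R alpha N n W k B) => //.
  - by rewrite size_map -AN.
  - exact: undup_uniq.
  - by move=> _ /memX[b [d [/Br bn /Br dn ->]]]; apply: addn_range.
  - by move=> b d bB dB; rewrite mem_undup; apply/allpairsP; exists (b, d).
  - move=> b d bB dB; have [|m mM bdm] := Mnet (b * d)%N.
      by apply/allpairsP; exists (b, d).
    exists m => //; exact: dist_nat_le bdm nl.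
have PX : ((size X)%:R%:E <= packing_number (sumset [set` A] [set` A]) delta)%E.
  apply: (size_le_packing_multiples d0); first exact: undup_uniq.
    move=> _ /memX[b [d [/memB[a aA ->] /memB[a' a'A ->] ->]]].
    by rewrite natrD mulrDr !idxE//; exists a => //; exists a'.
  move=> x y _ _ xy; rewrite divff ?gt_eqF//.
  exact: dist_nat_ge1.
have PM : ((size M)%:R%:E <= packing_number (productset [set` A] [set` A]) delta)%E.
  apply: (@size_le_packing_multiples _ _ _ (delta ^+ 2)) => //; first by rewrite exprn_gt0.
    move=> _ /Ms/allpairsP[[b d] /= [/memB[a aA ->] /memB[a' a'A ->] ->]].
    rewrite natrM expr2 mulrACA !idxE//; exists a => //; exists a' => //.
  move=> x y xM yM xy; have := Msep _ _ xM yM xy; rewrite /near -leNgt.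
  suff -> : delta / delta ^+ 2 = Q by [].
  by rewrite dE; field; rewrite gt_eqF.
apply: le_trans (lee_pmul _ _ PX PM); rewrite ?lee_fin//.
rewrite mulrC ler_pdivrMr// -natrM; apply: le_trans key.
by rewrite ler_powR//; lra.
Qed.
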